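(* Let $N\ge 1$, $\mu_1,\dots,\mu_N>0$, $\alpha>0$, $\beta>0$, $\gamma\in\mathbb{R}$, $c\ge 0$, $\lambda>0$, and put $\Lambda:=\sum_{i=1}^N\mu_i$. Define $$\theta_i:=\mu_i^{\gamma-1}\exp\!\left(-\alpha c/\mu_i^\beta\right),\qquad G(K):=\sum_{i=1}^N\min\!\left\{\mu_i,\frac{\mu_i\theta_i}{K}\right\}\quad (K>0).$$ Assume $\lambda<\Lambda$. Then the equation $\lambda=G(K)$ has a unique solution $K^*>0$. The reflected ODE associated with the Reflected UAS routing law has a unique equilibrium $q^*\in\mathbb{R}_+^N$, and it is given coordinatewise by $$q_i^*=\max\!\left\{0,\ \frac{\mu_i^\beta}{\alpha}\log\!\left(\frac{\theta_i}{K^*}\right)\right\},\qquad i=1,\dots,N.$$ Moreover, for every $i$, $q_i^*>0$ if and only if $K^*<\theta_i$.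
   Context: Here $\mathbb{R}_+^N=[0,\infty)^N$. The routing law is $p_i(q)=w_i(q)/\sum_{j=1}^N w_j(q)$ with $w_i(q)=\mu_i^\gamma\exp(-\alpha(q_i+c)/\mu_i^\beta)$. The unconstrained drift is $F_i(q)=\lambda p_i(q)-\mu_i$. The reflected ODE on $\mathbb{R}_+^N$ is $\dot q_i=\Gamma_i(q)$, where $\Gamma_i(q)=F_i(q)$ if $q_i>0$ and $\Gamma_i(q)=\max\{F_i(q),0\}$ if $q_i=0$. An equilibrium is a point $q^*\in\mathbb{R}_+^N$ with $\Gamma_i(q^* )=0$ for all $i$; equivalently, $q_i^*\ge 0$, $\lambda p_i(q^* )\le\mu_i$ and $q_i^*(\mu_i-\lambda p_i(q^* ))=0$ for all $i$. *)

(* Defs.v *)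
From HB Require Import structures.
From mathcomp Require Import all_boot all_order all_algebra.
From mathcomp Require Import all_classical all_reals all_analysis.

Set Implicit Arguments.
Unset Strict Implicit.
Unset Printing Implicit Defensive.

Import Order.TTheory GRing.Theory Num.Theory.

Local Open Scope ring_scope.

(* Points of R^N, and the vector mu of service rates, are row vectors, with
   i-th coordinate [q 0 i]. *)

Definition weight (R : realType) (N : nat) (mu : 'rV[R]_N)
    (alpha beta gamma c : R) (q : 'rV[R]_N) (i : 'I_N) : R :=
  mu 0 i `^ gamma * expR (- (alpha * (q 0 i + c) / mu 0 i `^ beta)).

Definition routing (R : realType) (N : nat) (mu : 'rV[R]_N)
    (alpha beta gamma c : R) (q : 'rV[R]_N) (i : 'I_N) : R :=
  weight mu alpha beta gamma c q i /
  \sum_(j < N) weight mu alpha beta gamma c q j.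

Definition drift (R : realType) (N : nat) (mu : 'rV[R]_N)
    (alpha beta gamma c lambda : R) (q : 'rV[R]_N) (i : 'I_N) : R :=
  lambda * routing mu alpha beta gamma c q i - mu 0 i.

(* The right-hand side Gamma of the reflected ODE; it is only meaningful for q
   in the nonnegative orthant. *)
Definition reflected_drift (R : realType) (N : nat) (mu : 'rV[R]_N)
    (alpha beta gamma c lambda : R) (q : 'rV[R]_N) (i : 'I_N) : R :=
  if 0 < q 0 i then drift mu alpha beta gamma c lambda q i
  else Num.max (drift mu alpha beta gamma c lambda q i) 0.

Definition equilibrium (R : realType) (N : nat) (mu : 'rV[R]_N)
    (alpha beta gamma c lambda : R) (q : 'rV[R]_N) : Prop :=
  (forall i, 0 <= q 0 i) /\
  (forall i, reflected_drift mu alpha beta gamma c lambda q i = 0).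

Definition theta (R : realType) (N : nat) (mu : 'rV[R]_N)
    (alpha beta gamma c : R) (i : 'I_N) : R :=
  mu 0 i `^ (gamma - 1) * expR (- (alpha * c / mu 0 i `^ beta)).

Definition G (R : realType) (N : nat) (mu : 'rV[R]_N)
    (alpha beta gamma c K : R) : R :=
  \sum_(i < N)
    Num.min (mu 0 i) (mu 0 i * theta mu alpha beta gamma c i / K).

(* Main.v *)
(** With [s_i = alpha / mu_i ^ beta], the weights are
    [w_i(q) = mu_i theta_i exp(- s_i q_i)].  Put [K = (\sum_j w_j(q)) / lambda].
    Then [lambda p_i(q) - mu_i = mu_i (theta_i exp(- s_i q_i) / K - 1)], so [q] is
    an equilibrium iff [q_i = max(0, log(theta_i / K) / s_i)] for all [i]; for
    such a [q] we have [theta_i exp(- s_i q_i) = min(theta_i, K)], and summing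
    over [i] turns the definition of [K] into [lambda = G(K)].  Finally [G] is
    continuous and nonincreasing, strictly so wherever it is below
    [\sum_i mu_i], which makes the level [K] unique. *)
Require Import Defs.
From HB Require Import structures.
From mathcomp Require Import all_boot all_order all_algebra.
From mathcomp Require Import all_classical all_reals all_analysis.
From mathcomp Require Import ring.

Set Implicit Arguments.
Unset Strict Implicit.
Unset Printing Implicit Defensive.

Import Order.TTheory GRing.Theory Num.Theory.
Import numFieldNormedType.Exports.
Local Open Scope ring_scope.

(** Intermediate value theorem: the sum tends to 0 for large [K] and reaches [\sum_i a i] once [K]
    is below every [t i]. *)
Lemma capped_sum_level_exists (R : realType) (I : finType) (a t : I -> R)
    (l : R) :
  (forall i, 0 < a i) -> (forall i, 0 < t i) -> 0 < l < \sum_i a i ->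
  exists2 K : R, 0 < K & l = \sum_i Num.min (a i) (a i * t i / K).
Proof.
move=> a_gt0 t_gt0 /andP[l_gt0 l_lt].
(* In the variable [x = K^-1] the sum is continuous on all of [R]. *)
pose h (x : R) : R := \sum_i Num.min (a i) (a i * t i * x).
have h_cont : continuous h.
  apply: (continuous_big (op := +%R)) => [|i _]; first exact: add_continuous.
  move=> x; apply: (@continuous_min R R (cst (a i)) (fun x => a i * t i * x)).
    exact: cst_continuous.
  exact: mulrl_continuous.
(* All terms being positive, [b] dominates each [(t i)^-1], so at [x = b] every minimum equals its
   cap [a i]. *)
pose b := \sum_i (t i)^-1.
have b_ge0 : 0 <= b by apply: sumr_ge0 => i _; rewrite invr_ge0 ltW.
have h0 : h 0 = 0.
  by apply: big1 => i _; rewrite mulr0; apply/min_idPr; rewrite ltW.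
have hb : h b = \sum_i a i.
  apply: eq_bigr => i _; apply/min_idPl; rewrite -mulrA ler_peMr ?(ltW (a_gt0 i))//.
  rewrite mulrC -ler_pdivrMr// div1r /b (bigD1 i)//= lerDl.
  by apply: sumr_ge0 => j _; rewrite invr_ge0 ltW.
have [|x] := @IVT R h 0 b l b_ge0 (continuous_subspaceT h_cont).
  by rewrite h0 hb ge_min le_max (ltW l_gt0) (ltW l_lt) orbT.
rewrite in_itv/= => /andP[x_ge0 _] hx.
have x_gt0 : 0 < x.
  rewrite lt_neqAle x_ge0 andbT; apply/eqP => x0.
  by move: l_gt0; rewrite -hx -x0 h0 ltxx.
by exists x^-1; rewrite ?invr_gt0// invrK.
Qed.

(** Each term is nonincreasing in the level, so equal sums force equal terms. A term below its cap
    would change strictly; hence all terms are capped, against the strict bound. *)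
Lemma capped_sum_level_unique (R : realType) (I : finType) (a t : I -> R)
    (K1 K2 : R) :
  (forall i, 0 < a i) -> (forall i, 0 < t i) -> 0 < K1 -> 0 < K2 ->
  \sum_i Num.min (a i) (a i * t i / K1) < \sum_i a i ->
  \sum_i Num.min (a i) (a i * t i / K1) =
    \sum_i Num.min (a i) (a i * t i / K2) ->
  K1 = K2.
Proof.
move=> a_gt0 t_gt0; wlog lt12 : K1 K2 / K1 < K2.
  move=> W K1_gt0 K2_gt0 lt_a eq12; have [lt12|lt21|//] := ltgtP K1 K2.
    exact: W.
  by apply/esym/W; rewrite -?eq12.
move=> K1_gt0 K2_gt0 lt_a eq12; exfalso.
have at_gt0 i : 0 < a i * t i by rewrite mulr_gt0.
have lt_at i : a i * t i / K2 < a i * t i / K1.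
  by rewrite ltr_pM2l// ltf_pV2.
have le_min i : 0 <= Num.min (a i) (a i * t i / K1)
                     - Num.min (a i) (a i * t i / K2).
  by rewrite subr_ge0 le_min ge_min lexx/= ge_min (ltW (lt_at i)) orbT.
have sum0 : \sum_i (Num.min (a i) (a i * t i / K1)
                     - Num.min (a i) (a i * t i / K2)) = 0.
  by rewrite sumrB eq12 subrr.
have eq_min := psumr_eq0P (fun i _ => le_min i) sum0.
suff eq_a : \sum_i Num.min (a i) (a i * t i / K2) = \sum_i a i.
  by move: lt_a; rewrite eq12 eq_a ltxx.
apply: eq_bigr => i _; apply/min_idPl; rewrite leNgt; apply/negP => lt_K2.
have /eqP := eq_min i isT; rewrite subr_eq0 => /eqP.
rewrite [RHS](min_idPr (ltW lt_K2)) => eqi.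
have : a i * t i / K2 < Num.min (a i) (a i * t i / K1) by rewrite lt_min lt_K2 lt_at.
by rewrite eqi ltxx.
Qed.

(** If [th > K], this [q] is the point where the exponential decay from [th] hits [K]; otherwise
    [q = 0] and nothing decays. *)
Lemma expR_level (R : realType) (th K s q : R) :
  0 < th -> 0 < K -> 0 < s -> q = Num.max 0 (s^-1 * ln (th / K)) ->
  th * expR (- (s * q)) = Num.min th K.
Proof.
move=> th_gt0 K_gt0 s_gt0 ->.
rewrite maxr_pMr ?ltW// mulr0 mulVKf ?gt_eqF//.
have thK_gt0 : 0 < th / K by rewrite divr_gt0.
have [le1|lt1] := leP (th / K) 1.
  rewrite (max_idPl _) ?ln_le0// oppr0 expR0 mulr1.
  by apply/esym/min_idPl; rewrite -[leRHS]mul1r -ler_pdivrMr.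
rewrite (max_idPr _) ?ln_ge0 ?ltW// -lnV ?posrE// lnK ?posrE ?invr_gt0//.
rewrite invf_div mulrCA divff ?gt_eqF// mulr1.
by apply/esym/min_idPr; rewrite ltW// -[ltLHS]mul1r -ltr_pdivlMr.
Qed.

(** For [q > 0], [D = 0] means [expR (s * q) = th / K]; for [q = 0], [D <= 0] means [th <= K], so
    the logarithm is nonpositive and the maximum is 0. *)
Lemma reflected_zeroP (R : realType) (m th K s q : R) :
  0 < m -> 0 < th -> 0 < K -> 0 < s ->
  let D := m * (th * expR (- (s * q)) / K - 1) in
  0 <= q /\ (if 0 < q then D else Num.max D 0) = 0 <->
  q = Num.max 0 (s^-1 * ln (th / K)).
Proof.
move=> m_gt0 th_gt0 K_gt0 s_gt0 D.
have thK_gt0 : 0 < th / K by rewrite divr_gt0.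
split=> [[q_ge0]|q_def].
  case: ltP => [q_gt0 /eqP|q_le0].
    rewrite mulf_eq0 gt_eqF//= subr_eq0 mulrAC.
    move=> /eqP eq1.
    have -> : th / K = expR (s * q).
      by rewrite -[LHS]mulr1 -(expRxMexpNx_1 (s * q)) mulrCA eq1 mulr1.
    by rewrite expRK mulKf ?gt_eqF// (max_idPr (ltW q_gt0)).
  have q0 : q = 0 by apply/eqP; rewrite eq_le q_le0 q_ge0.
  move=> /max_idPr; rewrite /D q0 mulr0 oppr0 expR0 mulr1.
  rewrite pmulr_rle0// subr_le0 => le1.
  by apply/esym/max_idPl; rewrite pmulr_rle0 ?invr_gt0// ln_le0.
have q_ge0 : 0 <= q by rewrite q_def le_max lexx.
split=> //; rewrite /D (@expR_level _ th K s q)//.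
case: ltP => [q_gt0|q_le0].
  have : 0 < s^-1 * ln (th / K) by move: q_gt0; rewrite q_def lt_max ltxx.
  rewrite pmulr_rgt0 ?invr_gt0// -{1}ln1 ltr_ln ?posrE// => lt1.
  have /min_idPr-> : K <= th by rewrite ltW// -[ltLHS]mul1r -ltr_pdivlMr.
  by rewrite divff ?gt_eqF// subrr mulr0.
apply/max_idPr; rewrite pmulr_rle0// subr_le0 ler_pdivrMr// mul1r.
by rewrite ge_min lexx orbT.
Qed.

Lemma weightE (R : realType) (N : nat) (mu : 'rV[R]_N)
    (alpha beta gamma c : R) (q : 'rV[R]_N) (i : 'I_N) :
  0 < mu 0 i ->
  weight mu alpha beta gamma c q i =
  mu 0 i * (theta mu alpha beta gamma c i *
            expR (- (alpha / mu 0 i `^ beta * q 0 i))).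
Proof.
move=> mu_gt0; rewrite /weight /theta.
have -> : mu 0 i `^ gamma = mu 0 i * mu 0 i `^ (gamma - 1).
  rewrite -{2}(powRr1 (ltW mu_gt0)) -powRD; last first.
    by rewrite (gt_eqF mu_gt0) implybT.
  by rewrite addrCA subrr addr0.
rewrite -!mulrA -expRD; congr (_ * (_ * expR _)); ring.
Qed.

Lemma theta_gt0 (R : realType) (N : nat) (mu : 'rV[R]_N)
    (alpha beta gamma c : R) (i : 'I_N) :
  0 < mu 0 i -> 0 < theta mu alpha beta gamma c i.
Proof. by move=> mu_gt0; rewrite mulr_gt0 ?powR_gt0 ?expR_gt0. Qed.

Lemma sum_weight_gt0 (R : realType) (N : nat) (mu : 'rV[R]_N)
    (alpha beta gamma c : R) (q : 'rV[R]_N) :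
  (0 < N)%N -> (forall i, 0 < mu 0 i) ->
  0 < \sum_(j < N) weight mu alpha beta gamma c q j.
Proof.
move=> N_gt0 mu_gt0; have w_gt0 j : 0 < weight mu alpha beta gamma c q j.
  by rewrite mulr_gt0 ?powR_gt0 ?expR_gt0.
rewrite (bigD1 (Ordinal N_gt0))//= ltr_pwDl// sumr_ge0// => j _.
exact: ltW.
Qed.

(** [K] is left free, since it is applied both to the root of [G] and to the level generated by an
    arbitrary [q]. *)
Definition level_point (R : realType) (N : nat) (mu : 'rV[R]_N)
    (alpha beta gamma c K : R) : 'rV[R]_N :=
  \row_i Num.max 0 (mu 0 i `^ beta / alpha *
                    ln (theta mu alpha beta gamma c i / K)).

(** The coordinates interact only through the total weight. With it held fixed, each one solves a
    scalar problem; the result is a fixed-point equation, with [q] on both sides. *)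
Lemma equilibriumP (R : realType) (N : nat) (mu : 'rV[R]_N)
    (alpha beta gamma c lambda : R) (q : 'rV[R]_N) :
  (0 < N)%N -> (forall i, 0 < mu 0 i) -> 0 < alpha -> 0 < lambda ->
  equilibrium mu alpha beta gamma c lambda q <->
  q = level_point mu alpha beta gamma c
        ((\sum_(j < N) weight mu alpha beta gamma c q j) / lambda).
Proof.
move=> N_gt0 mu_gt0 alpha_gt0 lambda_gt0.
have W_gt0 := @sum_weight_gt0 _ _ _ alpha beta gamma c q N_gt0 mu_gt0.
set W := \sum_(j < N) _ in W_gt0 *.
have K_gt0 : 0 < W / lambda by rewrite divr_gt0.
have driftE i : drift mu alpha beta gamma c lambda q i =
    mu 0 i * (theta mu alpha beta gamma c i *
      expR (- (alpha / mu 0 i `^ beta * q 0 i)) / (W / lambda) - 1).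
  rewrite /drift /routing -/W weightE//; field.
  by rewrite !gt_eqF.
have zeroP i := @reflected_zeroP _ _ _ _ _ (q 0 i) (mu_gt0 i)
  (@theta_gt0 _ _ _ alpha beta gamma c _ (mu_gt0 i)) K_gt0
  (divr_gt0 alpha_gt0 (powR_gt0 beta (mu_gt0 i))).
split=> [[q_ge0 q_zero]|q_def].
  apply/rowP => i; rewrite mxE -invf_div; apply/zeroP; split=> //.
  by rewrite -driftE; exact: q_zero.
have q_coord i : 0 <= q 0 i /\ reflected_drift mu alpha beta gamma c lambda q i = 0.
  rewrite /reflected_drift driftE; apply/zeroP.
  by rewrite invf_div {1}q_def mxE.
by split=> i; have [] := q_coord i.
Qed.

(** Each weight is [mu 0 i] times the minimum of [theta] and [K]; factoring out [K] leaves the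
    summand of [G]. *)
Lemma sum_weight_level_point (R : realType) (N : nat) (mu : 'rV[R]_N)
    (alpha beta gamma c K : R) :
  (forall i, 0 < mu 0 i) -> 0 < alpha -> 0 < K ->
  \sum_(j < N)
    weight mu alpha beta gamma c (level_point mu alpha beta gamma c K) j =
  K * G mu alpha beta gamma c K.
Proof.
move=> mu_gt0 alpha_gt0 K_gt0; rewrite /G mulr_sumr; apply: eq_bigr => i _.
rewrite weightE// (@expR_level _ _ K) ?theta_gt0 ?divr_gt0 ?powR_gt0//; last first.
  by rewrite mxE invf_div.
rewrite !minr_pMr ?ltW// minC [K * mu 0 i]mulrC; congr Num.min.
by rewrite [RHS]mulrC divfK ?gt_eqF.
Qed.

Theorem theorem3p3 (R : realType) (N : nat) (mu : 'rV[R]_N)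
    (alpha beta gamma c lambda : R) :
  (1 <= N)%N ->
  (forall i, 0 < mu 0 i) ->
  0 < alpha -> 0 < beta -> 0 <= c -> 0 < lambda ->
  lambda < \sum_(i < N) mu 0 i ->
  exists Kstar : R,
    unique (fun K => 0 < K /\ lambda = G mu alpha beta gamma c K) Kstar /\
    exists qstar : 'rV[R]_N,
      unique (equilibrium mu alpha beta gamma c lambda) qstar /\
      (forall i, qstar 0 i =
         Num.max 0 (mu 0 i `^ beta / alpha *
                    ln (theta mu alpha beta gamma c i / Kstar))) /\
      (forall i, 0 < qstar 0 i <-> Kstar < theta mu alpha beta gamma c i).
Proof.
move=> N_gt0 mu_gt0 alpha_gt0 _ _ lambda_gt0 lambda_lt.
have th_gt0 i : 0 < theta mu alpha beta gamma c i by exact: theta_gt0.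
have [|K K_gt0 GK] := capped_sum_level_exists (l := lambda) mu_gt0 th_gt0.
  by rewrite lambda_gt0.
have K_unique K' : 0 < K' -> lambda = G mu alpha beta gamma c K' -> K = K'.
  move=> K'_gt0 GK'.
  (* The load condition [lambda < \sum_i mu 0 i] supplies the strict bound. *)
  apply: (capped_sum_level_unique mu_gt0 th_gt0) => //; first by rewrite -GK.
  by rewrite -GK; exact: GK'.
exists K; split; first by split=> // K' [? ?]; exact: K_unique.
exists (level_point mu alpha beta gamma c K); split; [split|split].
(* The total weight at this point is [K * lambda], so the level it generates is [K] again. *)
- apply/equilibriumP => //; congr level_point.
  by rewrite sum_weight_level_point// /G -GK mulfK ?gt_eqF.
(* Any equilibrium generates a level [Kq] whose total weight is both [Kq * lambda] and [Kq * G(Kq)];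
   cancelling [Kq] makes it a root, hence equal to [K]. *)
- move=> q /(equilibriumP _ _ _ _ N_gt0 mu_gt0 alpha_gt0 lambda_gt0).
  set Kq := _ / lambda => q_def.
  have Kq_gt0 : 0 < Kq by rewrite divr_gt0 ?sum_weight_gt0.
  rewrite q_def (K_unique Kq)//.
  apply: (mulfI (lt0r_neq0 Kq_gt0)); rewrite -sum_weight_level_point// -q_def.
  by rewrite /Kq divfK ?gt_eqF.
- by move=> i; rewrite mxE.
- move=> i; rewrite mxE lt_max ltxx/= pmulr_rgt0 ?divr_gt0 ?powR_gt0//.
  by rewrite -ln1 ltr_ln ?posrE ?divr_gt0// ltr_pdivlMr// mul1r.
Qed.
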